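(* Let $x$ be a variable and for $k\ge 0$ let $b_k=B_{2k+1}\!\left(\frac{x+1}{2}\right)$, where $B_m(\cdot)$ denotes the $m$th Bernoulli polynomial. Then for all integers $n\geq 0$, $$H_n(b_k)=\det_{0\le i,j\le n}\big(b_{i+j}\big) = (-1)^{\binom{n+1}{2}}\left(\frac{x}{2}\right)^{n+1}\prod_{\ell=1}^{n}\left(\frac{\ell^{4}(x^{2}-\ell^{2})}{4(2\ell+1)(2\ell-1)}\right)^{n+1-\ell}.$$
   Context: The Bernoulli polynomials $B_n(x)$ are defined by $\frac{te^{xt}}{e^t-1}=\sum_{n\ge 0}B_n(x)\frac{t^n}{n!}$. For a sequence $(c_k)_{k\ge 0}$ of numbers or polynomials, the $n$th Hankel determinant is $H_n(c_k)=\det_{0\le i,j\le n}(c_{i+j})$, the determinant of an $(n+1)\times(n+1)$ matrix. Empty products equal $1$. *)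

(* Defs.v *)
From mathcomp Require Import all_boot all_order all_algebra.

Set Implicit Arguments.
Unset Strict Implicit.
Unset Printing Implicit Defensive.

Import GRing.Theory.
Local Open Scope ring_scope.

(* Formal power series in t over Q[x], given by their coefficient sequences. *)
Definition series := nat -> {poly rat}.

Definition mul_series (f g : series) : series :=
  fun n => \sum_(i < n.+1) f i * g (n - i)%N.

Definition sub_series (f g : series) : series := fun n => f n - g n.

Definition one_series : series := fun n => (n == 0%N)%:R.

Definition t_series : series := fun n => (n == 1%N)%:R.

(* sum_n (a_n / n!) t^n *)
Definition egf (a : nat -> {poly rat}) : series :=
  fun n => (n`!%:R : rat)^-1 *: a n.

(* e^(a t) *)
Definition exp_series (a : {poly rat}) : series := egf (fun n => a ^+ n).

(* The generating function identity sum_n B_n(x) t^n/n! = t e^(xt) / (e^t - 1),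
   with the denominator cleared: e^t - 1 has zero constant term, so it is not
   invertible as a power series, but it is cancellable.  By [bernoulli_ex] and
   [bernoulli_uniq] the identity determines B. *)
Definition is_bernoulli (B : nat -> {poly rat}) : Prop :=
  mul_series (egf B) (sub_series (exp_series 1) one_series) =1
  mul_series t_series (exp_series 'X).

Definition hankel (n : nat) (c : nat -> {poly rat}) : {poly rat} :=
  \det (\matrix_(i < n.+1, j < n.+1) c (i + j)%N).

Section Quotient.

Variable g : series.
Hypotheses (g0 : g 0%N = 0) (g1 : g 1%N = 1).

Lemma mul_seriesS h n :
  mul_series h g n.+1 = \sum_(i < n) h i * g (n.+1 - i)%N + h n.
Proof.
by rewrite /mul_series !big_ord_recr /= subnn g0 mulr0 addr0 subSnn g1 mulr1.
Qed.

Lemma series_div_ex f : f 0%N = 0 -> exists h, mul_series h g =1 f.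
Proof.
move=> f0.
pose next s n := f n.+1 - \sum_(i < n) s`_i * g (n.+1 - i)%N.
pose fix hs n := if n is m.+1 then rcons (hs m) (next (hs m) m) else [::].
have sz n : size (hs n) = n by elim: n => //= n IHn; rewrite size_rcons IHn.
have nth_hs i n : (i < n)%N -> (hs n)`_i = next (hs i) i.
  elim: n => //= n IHn; rewrite ltnS leq_eqVlt nth_rcons sz.
  by case/predU1P=> [-> | lt_in]; rewrite ?ltnn ?eqxx // lt_in IHn.
exists (fun n => next (hs n) n) => -[|n].
  by rewrite /mul_series big_ord1 g0 mulr0 f0.
rewrite mul_seriesS [X in _ + X]/next addrCA -[RHS]addr0; congr (_ + _).
apply/eqP; rewrite subr_eq0; apply/eqP/eq_bigr => i _.
by rewrite nth_hs.
Qed.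

Lemma series_div_uniq h h' :
  mul_series h g =1 mul_series h' g -> h =1 h'.
Proof.
move=> eq_hh' n; elim/ltn_ind: n => n IHn.
have := eq_hh' n.+1; rewrite !mul_seriesS.
under eq_bigr => i _ do rewrite IHn //.
by move/addrI.
Qed.

End Quotient.

Lemma expm1_0 : sub_series (exp_series 1) one_series 0 = 0.
Proof. by rewrite /sub_series /exp_series /egf fact0 invr1 scale1r subrr. Qed.

Lemma expm1_1 : sub_series (exp_series 1) one_series 1 = 1.
Proof. by rewrite /sub_series /exp_series /egf invr1 scale1r subr0. Qed.

Lemma bernoulli_ex : exists B, is_bernoulli B.
Proof.
have [|h hE] := series_div_ex expm1_0 expm1_1
  (f := mul_series t_series (exp_series 'X)).
  by rewrite /mul_series big_ord1 mul0r.
exists (fun n => (n`!%:R : rat) *: h n) => n; rewrite -hE.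
apply: eq_bigr => i _; rewrite /egf scalerA mulVf ?scale1r //.
by rewrite Num.Theory.pnatr_eq0 -lt0n fact_gt0.
Qed.

Lemma bernoulli_uniq B B' : is_bernoulli B -> is_bernoulli B' -> B =1 B'.
Proof.
move=> BP B'P n.
have /(series_div_uniq expm1_0 expm1_1)/(_ n)/scalerI :
    mul_series (egf B) (sub_series (exp_series 1) one_series) =1
    mul_series (egf B') (sub_series (exp_series 1) one_series).
  by move=> k; rewrite BP B'P.
by apply; rewrite invr_eq0 Num.Theory.pnatr_eq0 -lt0n fact_gt0.
Qed.

(* Main.v *)
Require Import Defs.
From mathcomp Require Import all_boot all_order all_algebra.
From HB Require Import structures.
From mathcomp Require Import ring.
Import GRing.Theory.
Local Open Scope ring_scope.

Set Implicit Arguments.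
Unset Strict Implicit.
Unset Printing Implicit Defensive.

(** Put a = (x + 1) / 2, let Lam be the linear functional on Q[x][u] with
    Lam(u^m) = B_m(a), and let L(p) = Lam(u p(u^2)), a functional on Q[x][y]
    with L(y^k) = b_k.  The Hankel matrix is the Gram matrix of L on the powers
    of y, and its determinant does not change when the rows and the columns are
    rewritten in two other families of monic polynomials, one of each degree
    ([det_gram_monic]).  A good choice is

      phi_k = prod_(i < k) (y - (a + i)^2),
      psi_j = prod_(i < j) (y - (1 - a + i)^2),

    the bases in which the Wilson polynomials with parameters a, a, 1 - a, 1 - a,
    in the variable - y, orthogonal for L, are hypergeometric sums.

    For these L(phi_k psi_j) is explicit.  The difference equation of the
    Bernoulli polynomials says Lam(f(u + 1) - f(u)) = f'(a) for every f
    ([umbral_shift]).  Now phi_k(u^2) psi_j(u^2) is a product of two runs of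
    k + j consecutive linear factors, around u - a and around u + a, and

      2 (k + j + 1) u phi_k(u^2) psi_j(u^2) = F(u + 1) - F(u),

    where F extends each run by one factor.  Hence 2 (k + j + 1) L(phi_k psi_j)
    is F'(a), and because F vanishes at a this is a product of linear factors in
    x ([odd_umbral_wilson]).  It splits as x times a factor depending on k times
    a factor depending on j, so up to scaling of rows and columns the Gram
    matrix is the Hilbert matrix 1 / (k + j + 1), whose determinant is found by
    eliminating the last row and column repeatedly ([det_hilbert]). *)

(** * Rising and falling factorials *)

Definition falling (T : comNzRingType) (t : T) k : T := \prod_(i < k) (t - i%:R).

Definition rising (T : comNzRingType) (t : T) k : T := \prod_(i < k) (t + i%:R).

Lemma falling_recr (T : comNzRingType) (t : T) k :
  falling t k.+1 = falling t k * (t - k%:R).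
Proof. by rewrite /falling big_ord_recr. Qed.

Lemma falling_recl (T : comNzRingType) (t : T) k :
  falling t k.+1 = t * falling (t - 1) k.
Proof.
rewrite /falling big_ord_recl subr0; congr (_ * _).
by apply: eq_bigr => i _; rewrite lift0 -natr1; ring.
Qed.

Lemma rising_recr (T : comNzRingType) (t : T) k :
  rising t k.+1 = rising t k * (t + k%:R).
Proof. by rewrite /rising big_ord_recr. Qed.

(** Both sides are the product of the k + 1 factors starting at t; this form
    makes shifting the argument cost one factor at each end. *)
Lemma rising_shift (T : comNzRingType) (t : T) k :
  t * rising (t + 1) k = rising t k * (t + k%:R).
Proof.
rewrite -rising_recr /rising big_ord_recl addr0; congr (_ * _).
by apply: eq_bigr => i _; rewrite lift0 -natr1; ring.
Qed.

Lemma rmorph_falling (T U : comNzRingType) (f : {rmorphism T -> U}) t k :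
  f (falling t k) = falling (f t) k.
Proof.
by rewrite rmorph_prod; apply: eq_bigr => i _; rewrite rmorphB rmorph_nat.
Qed.

Lemma rmorph_rising (T U : comNzRingType) (f : {rmorphism T -> U}) t k :
  f (rising t k) = rising (f t) k.
Proof.
by rewrite rmorph_prod; apply: eq_bigr => i _; rewrite rmorphD rmorph_nat.
Qed.

(** * Determinants *)

Lemma det_scale (R : comNzRingType) n (r s : nat -> R) (A : nat -> nat -> R) :
  \det (\matrix_(i < n, j < n) (r i * A i j * s j)) =
  (\prod_(i < n) (r i * s i)) * \det (\matrix_(i < n, j < n) A i j).
Proof.
have -> : \matrix_(i < n, j < n) (r i * A i j * s j) =
    diag_mx (\row_i r i) *m (\matrix_(i < n, j < n) A i j)
      *m diag_mx (\row_j s j).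
  by rewrite mul_diag_mx mul_mx_diag; apply/matrixP => i j; rewrite !mxE.
rewrite !det_mulmx !det_diag mulrAC -big_split /=.
by congr (_ * _); apply: eq_bigr => i _; rewrite !mxE.
Qed.

Lemma poly_sumXn (R : nzRingType) n (p : {poly R}) : (size p <= n)%N ->
  p = \sum_(k < n) p`_k *: 'X^k.
Proof.
move=> le_pn; rewrite -poly_def; apply/polyP => k; rewrite coef_poly.
by case: ltnP => // le_nk; rewrite nth_default // (leq_trans le_pn).
Qed.

(** The change of basis from powers of X to a monic family with one polynomial
    of each degree is triangular with ones on the diagonal. *)
Lemma det_gram_monic (R : comNzRingType) (L : {scalar {poly R}}) n
    (p q : nat -> {poly R}) :
    (forall i, p i \is monic /\ size (p i) = i.+1) ->
    (forall i, q i \is monic /\ size (q i) = i.+1) ->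
  \det (\matrix_(i < n, j < n) L (p i * q j)) =
  \det (\matrix_(i < n, j < n) L 'X^(i + j)).
Proof.
move=> pP qP.
pose C (s : nat -> {poly R}) : 'M[R]_n := \matrix_(i < n, k < n) (s i)`_k.
have detC s : (forall i, s i \is monic /\ size (s i) = i.+1) -> \det (C s) = 1.
  move=> sP; rewrite det_trig.
    rewrite big1 // => i _; rewrite mxE.
    by have [/monicP <- sz] := sP i; rewrite lead_coefE sz.
  apply/is_trig_mxP => i j lt_ij.
  by rewrite mxE nth_default //; have [_ ->] := sP i.
have expand s (i : 'I_n) : (forall i, s i \is monic /\ size (s i) = i.+1) ->
    s i = \sum_(k < n) C s i k *: 'X^k.
  move=> sP; have [_ sz] := sP i; rewrite {1}[s i](@poly_sumXn _ n) ?sz //.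
  by apply: eq_bigr => k _; rewrite mxE.
have -> : \matrix_(i < n, j < n) L (p i * q j) =
    C p *m (\matrix_(i < n, j < n) L 'X^(i + j)) *m (C q)^T.
  apply/matrixP => i j; rewrite !mxE (expand p i pP) (expand q j qP).
  rewrite big_distrr /= linear_sum; apply: eq_bigr => l _.
  rewrite -scalerAr linearZ /= mulrC !mxE; congr (_ * _).
  rewrite big_distrl /= linear_sum; apply: eq_bigr => k _.
  by rewrite -scalerAl linearZ /= !mxE exprD.
by rewrite !det_mulmx det_tr !detC // mul1r mulr1.
Qed.

(** Elimination of the last row and column with pivot f n n.  Stated for entries
    given by a function on nat, so that the smaller determinant is again of this
    form. *)
Lemma det_schur (F : fieldType) (f : nat -> nat -> F) n : f n n != 0 ->
  \det (\matrix_(i < n.+1, j < n.+1) f i j) =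
  f n n * \det (\matrix_(i < n, j < n) (f i j - f i n * f n j / f n n)).
Proof.
move=> fn0; rewrite -[n.+1]addn1.
set S := (X in f n n * \det X).
pose b : 'M_(n, 1) := \matrix_(i < n, _ < 1) (f i n / f n n).
pose c : 'M_(1, n) := \matrix_(_ < 1, j < n) f n j.
have -> : \matrix_(i < n + 1, j < n + 1) f i j =
    block_mx 1%:M b 0 1%:M *m block_mx S 0 c (f n n)%:M.
  rewrite mulmx_block !mul1mx !mul0mx !add0r.
  apply/matrixP => i j; rewrite !mxE.
  case: splitP => i' Ei; rewrite !mxE; case: splitP => j' Ej; rewrite !mxE ?Ei ?Ej.
  - by rewrite big_ord1 !mxE mulrAC subrK.
  - by rewrite big_ord1 !mxE !ord1 eqxx mulr1n addn0 divfK.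
  - by rewrite ord1 addn0.
  by rewrite !ord1 eqxx addn0 mulr1n.
by rewrite det_mulmx det_ublock det_lblock !det1 !mul1r det_scalar1 mulrC.
Qed.

(** The left-hand side is the factor that elimination produces when the Hilbert
    matrix grows from size m to m + 1; the right-hand side expresses it through
    the factors l^2 / (4 (2l - 1) (2l + 1)) of the final formula, with l.+1 in
    place of l; the remaining l^2 there comes from the scaling of the Gram
    matrix. *)
Lemma hilbert_pivot m :
  (2 * m).+1%:R^-1 * (\prod_(l < m) (l.+1%:R / (m + l.+1)%:R)) ^+ 2 =
  \prod_(l < m) (l.+1%:R ^+ 2 / (4 * (2 * l%:R + 1) * (2 * l%:R + 3))) :> rat.
Proof.
have eq_rising k : \prod_(l < k) (l.+1%:R / (k + l.+1)%:R) =
    \prod_(l < k) l.+1%:R / rising (k.+1%:R : rat) k.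
  rewrite prodf_div; congr (_ / _); apply: eq_bigr => l _.
  by rewrite -natrD addnS addSn.
have rising_n0 k : rising (k.+1%:R : rat) k != 0.
  by apply/prodf_neq0 => l _; rewrite -natrD Num.Theory.pnatr_eq0.
rewrite eq_rising; elim: m => [|m IHm].
  by rewrite /rising !big_ord0 muln0 invr1 !mul1r.
rewrite [RHS]big_ord_recr -IHm [in LHS]big_ord_recr /=.
have := rising_shift (m.+1%:R : rat) m.+1.
rewrite natr1 [in X in _ = X]rising_recr -!natrD => Erise.
have -> : rising (m.+2%:R : rat) m.+1 =
    rising m.+1%:R m * (m.+1 + m)%:R * (m.+1 + m.+1)%:R / m.+1%:R.
  by rewrite -Erise mulrAC divff ?mul1r // Num.Theory.pnatr_eq0.
move: (rising_n0 m); set r := rising _ _ => r_n0.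
have -> : (2 * m.+1).+1 = (2 * m + 3)%N by rewrite mulnS addnC !addnS.
rewrite mul2n -addnn -[(m + m).+1]addn1 -[m.+1]addn1 !natrD.
field; rewrite r_n0 -?natrM ?natr1 -?natrD ?Num.Theory.pnatr_eq0 //.
by rewrite addn3.
Qed.

(** Eliminating the last row and column of the Hilbert matrix scales it, since
    1 / (i + j + 1) - (2n + 1) / ((i + n + 1) (n + j + 1)) equals
    (n - i) (n - j) / ((n + i + 1) (n + j + 1)) times 1 / (i + j + 1). *)
Lemma det_hilbert n :
  \det (\matrix_(i < n, j < n) ((i + j).+1%:R : rat)^-1) =
  \prod_(m < n) \prod_(l < m)
    (l.+1%:R ^+ 2 / (4 * (2 * l%:R + 1) * (2 * l%:R + 3))).
Proof.
elim: n => [|n IHn]; first by rewrite det_mx00 big_ord0.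
rewrite big_ord_recr /= -IHn mulrC -hilbert_pivot.
rewrite (@det_schur _ (fun i j => (i + j).+1%:R^-1)); last first.
  by rewrite invr_eq0 Num.Theory.pnatr_eq0.
rewrite -mulrA addnn mul2n; congr (_ * _).
pose r i : rat := (n%:R - i%:R) / (n + i.+1)%:R.
have -> : \prod_(l < n) (l.+1%:R / (n + l.+1)%:R) = \prod_(l < n) r l.
  rewrite !prodf_div; congr (_ / _); rewrite (reindex_inj rev_ord_inj) /=.
  by apply: eq_bigr => l _; rewrite -subSn // subSS natrB // ltnW.
rewrite expr2 -big_split -(det_scale n r r (fun i j => (i + j).+1%:R^-1)).
congr (\det _); apply/matrixP => i j.
rewrite !mxE /r -addnn !addnS -!natr1 !natrD.
by field; rewrite -?natrD ?natr1 ?Num.Theory.pnatr_eq0.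
Qed.

(** * Umbral functionals and the Bernoulli difference equation *)

Section Umbral.

Variables (R : comNzRingType) (c : nat -> R).

Definition umbral (p : {poly R}) : R := \sum_(k < size p) p`_k * c k.

Lemma umbralE m (p : {poly R}) :
  (size p <= m)%N -> umbral p = \sum_(k < m) p`_k * c k.
Proof.
move=> le_pm; rewrite /umbral (big_ord_widen m (fun k => p`_k * c k)) //.
rewrite big_mkcond; apply: eq_bigr => k _.
by case: ltnP => // /(nth_default _) ->; rewrite mul0r.
Qed.

Fact umbral_is_linear : linear_for *%R umbral.
Proof.
move=> a p q; set m := maxn (size p) (size q).
have lep : (size p <= m)%N by rewrite leq_maxl.
have leq : (size q <= m)%N by rewrite leq_maxr.
rewrite (umbralE lep) (umbralE leq) (@umbralE m).
  rewrite mulr_sumr -big_split; apply: eq_bigr => k _ /=.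
  by rewrite coefD coefZ mulrDl mulrA.
rewrite (leq_trans (size_polyD _ _)) // geq_max leq andbT.
exact: leq_trans (size_scale_leq _ _) lep.
Qed.

HB.instance Definition _ :=
  GRing.isLinear.Build R {poly R} R *%R umbral umbral_is_linear.

Lemma umbralXn m : umbral 'X^m = c m.
Proof.
rewrite /umbral size_polyXn big_ord_recr /= coefXn eqxx mul1r big1 ?add0r //.
by move=> i _; rewrite coefXn ltn_eqF // mul0r.
Qed.

(** Reads a polynomial in y = u^2 through the odd moments c (2 k + 1) alone. *)
Definition odd_umbral (p : {poly R}) : R := umbral ('X * (p \Po 'X^2)).

Fact odd_umbral_is_linear : linear_for *%R odd_umbral.
Proof.
move=> a p q; rewrite /odd_umbral comp_polyD comp_polyZ mulrDr -scalerAr.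
by rewrite linearD linearZ.
Qed.

HB.instance Definition _ :=
  GRing.isLinear.Build R {poly R} R *%R odd_umbral odd_umbral_is_linear.

Lemma odd_umbralXn m : odd_umbral 'X^m = c (2 * m + 1)%N.
Proof.
by rewrite /odd_umbral rmorphXn /= comp_polyX -exprM -exprS umbralXn addn1.
Qed.

End Umbral.

(** Compare the coefficients of t^m in the generating function identity; the
    subtracted term comes from the - 1 in e^t - 1. *)
Lemma bernoulli_sum B (hB : is_bernoulli B) m :
  \sum_(i < m.+1) B i *+ 'C(m, i) - B m = 'X^(m.-1) *+ m.
Proof.
have := congr1 ( *:%R (m`!%:R : rat)) (hB m).
have factn0 k : (k`!%:R : rat) != 0.
  by rewrite Num.Theory.pnatr_eq0 -lt0n fact_gt0.
rewrite /mul_series !scaler_sumr => eqB.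
have -> : 'X^(m.-1) *+ m = \sum_(i < m.+1)
    m`!%:R *: (t_series i * exp_series 'X (m - i)%N).
  case: m {eqB} => [|m].
    by rewrite big_ord1 /t_series mul0r scaler0 mulr0n.
  rewrite big_ord_recl /t_series mul0r scaler0 add0r big_ord_recl /= mul1r.
  rewrite big1 ?addr0 => [|i _]; last by rewrite mul0r scaler0.
  rewrite /exp_series /egf subSS subn0 scalerA factS natrM -mulrA divff //.
  by rewrite mulr1 scaler_nat.
rewrite -eqB big_ord_recr [in RHS]big_ord_recr /= binn mulr1n addrK.
rewrite subnn expm1_0 mulr0 scaler0 addr0; apply: eq_bigr => i _.
rewrite /sub_series /exp_series /egf /one_series expr1n subn_eq0 leqNgt ltn_ord.
rewrite subr0 -scalerAl -scalerAr mulr1 !scalerA -scaler_nat; congr (_ *: _).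
rewrite -(bin_fact (ltnW (ltn_ord i))) !natrM; field.
by rewrite !factn0.
Qed.

(** On the power u^m this is the classical recurrence of [bernoulli_sum]
    evaluated at a, and both sides are linear in p. *)
Lemma umbral_shift B (hB : is_bernoulli B) (a : {poly rat}) p :
  let c m := B m \Po a in
  umbral c (p \Po ('X + 1)) - umbral c p = p^`().[a].
Proof.
move=> c; rewrite -[p]coefK poly_def (linear_sum (comp_poly ('X + 1))).
rewrite (linear_sum deriv) !(linear_sum (umbral c)) -sumrB horner_sum.
apply: eq_bigr => m _.
rewrite /= comp_polyZ derivZ hornerZ !linearZ /= -mulrBr.
congr (_ * _).
rewrite rmorphXn /= comp_polyX exprD1n (linear_sum (umbral c)) umbralXn.
rewrite derivXn hornerMn hornerXn.
have := congr1 (comp_poly a) (bernoulli_sum hB m).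
rewrite rmorphB rmorph_sum rmorphMn rmorphXn /= comp_polyX => <-.
by congr (_ - _); apply: eq_bigr => i _; rewrite !raddfMn /= umbralXn.
Qed.

(** * The Gram matrix in the Wilson bases *)

Definition wilson_basis (R : comNzRingType) (a : R) k : {poly R} :=
  \prod_(i < k) ('X - ((a + i%:R) ^+ 2)%:P).

Lemma wilson_basisP (R : comNzRingType) (a : R) k :
  wilson_basis a k \is monic /\ size (wilson_basis a k) = k.+1.
Proof.
split; first exact: monic_prod_XsubC.
by rewrite size_prod_XsubC [index_enum _]unlock -enumT size_enum_ord.
Qed.

Lemma wilson_basis_sqr (R : comNzRingType) (a : R) k :
  wilson_basis a k \Po 'X^2 = falling ('X - a%:P) k * rising ('X + a%:P) k.
Proof.
rewrite rmorph_prod -big_split /=; apply: eq_bigr => i _.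
rewrite comp_polyB comp_polyX comp_polyC rmorphXn rmorphD rmorph_nat /=; ring.
Qed.

(** The polynomial u phi_k(u^2) psi_j(u^2) has an explicit discrete primitive F,
    up to the factor 2 (k + j + 1), so the functional only sees F'(a); as u - a
    is a factor of F, this is the value at a of the remaining factors. *)
Lemma odd_umbral_wilson (R : comNzRingType) (a : R) (c : nat -> R) k j :
    (forall p : {poly R},
       umbral c (p \Po ('X + 1)) - umbral c p = p^`().[a]) ->
  odd_umbral c (wilson_basis a k * wilson_basis (1 - a) j) *+ (2 * (k + j).+1) =
  (2 * a - 1) * (\prod_(l < k) (- l.+1%:R * (2 * a - 1 + l.+1%:R))) *
    \prod_(l < j) (l.+1%:R * (2 * a - 1 - l.+1%:R)).
Proof.
move=> shift_c; pose b := 1 - a.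
(* F is phi_k(u^2) psi_j(u^2) times (u - a - k) (u - b - j). *)
pose F : {poly R} := falling ('X - a%:P) k.+1 * rising ('X + a%:P) k *
  (falling ('X - b%:P) j.+1 * rising ('X + b%:P) j).
have DF : F \Po ('X + 1) - F =
    ('X * ((wilson_basis a k * wilson_basis b j) \Po 'X^2)) *+ (2 * (k + j).+1).
  rewrite /F !rmorphM /= !wilson_basis_sqr !(rmorph_falling, rmorph_rising) /=.
  rewrite !(comp_polyB, comp_polyD, comp_polyX, comp_polyC).
  (* Peeling the first factor off the falling runs of F(u + 1) leaves runs
     starting at u - a and u - b; those of F(u) are folded again and lose
     their last factor instead, so that the runs of both sides agree. *)
  rewrite !falling_recl.
  have -> : 'X + 1 - a%:P - 1 = 'X - a%:P :> {poly R} by ring.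
  have -> : 'X + 1 - b%:P - 1 = 'X - b%:P :> {poly R} by ring.
  rewrite -!falling_recl !falling_recr.
  have -> : 'X + 1 + a%:P = 'X + a%:P + 1 :> {poly R} by ring.
  have -> : 'X + 1 + b%:P = 'X + b%:P + 1 :> {poly R} by ring.
  have := rising_shift ('X + a%:P) k; have := rising_shift ('X + b%:P) j.
  have -> : b%:P = 1 - a%:P by rewrite rmorphB.
  set ra' := rising ('X + a%:P + 1) k; set rb' := rising (_ + 1) j.
  set ra := rising _ k; set rb := rising _ j.
  set da := falling _ k; set db := falling _ j => Erb Era.
  have -> : ('X + 1 - a%:P) * da * ra' * (('X + 1 - (1 - a%:P)) * db * rb') =
    da * db * (('X + a%:P) * ra') * (('X + (1 - a%:P)) * rb') by ring.
  rewrite Era Erb -[RHS]mulr_natr natrM -[(k + j).+1]addn1 !natrD; ring.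
rewrite /odd_umbral -linearMn -DF linearB shift_c /F falling_recl.
rewrite -!mulrA derivM derivXsubC mul1r hornerD [X in _ + X]hornerM.
rewrite hornerXsubC subrr mul0r addr0 falling_recl.
rewrite -[LHS]/(horner_eval a _) !rmorphM !(rmorph_falling, rmorph_rising) /=.
rewrite /horner_eval !(hornerD, hornerN, hornerX, hornerC).
have -> : \prod_(l < k) (- l.+1%:R * (2 * a - 1 + l.+1%:R)) =
    falling (a - a - 1) k * rising (a + a) k.
  by rewrite -big_split; apply: eq_bigr => l _; rewrite -natr1 /=; ring.
have -> : \prod_(l < j) (l.+1%:R * (2 * a - 1 - l.+1%:R)) =
    falling (a - b - 1) j * rising (a + b) j.
  by rewrite -big_split; apply: eq_bigr => l _; rewrite -natr1 /b /=; ring.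
rewrite /b; ring.
Qed.

(** * Evaluation of the Hankel determinant *)

(** Brings the product of powers into the form in which the Gram matrix delivers
    it, one inner product per row. *)
Lemma prod_staircase (R : comNzRingType) (g : nat -> R) n :
  \prod_(1 <= l < n.+1) g l ^+ (n.+1 - l) = \prod_(i < n.+1) \prod_(l < i) g l.+1.
Proof.
elim: n => [|n IHn]; first by rewrite big_geq // big_ord1 big_ord0.
rewrite big_ord_recr /= -IHn big_nat_recr //= subSnn expr1.
rewrite (eq_big_nat _ _ (F2 := fun l => g l ^+ (n.+1 - l) * g l)); last first.
  by move=> l /andP[_ lt_ln]; rewrite -exprSr subSn // ltnW.
rewrite big_split /= -mulrA; congr (_ * _).
by rewrite -big_nat_recr //= big_add1 big_mkord.
Qed.

Theorem theorem1p1 (B : nat -> {poly rat}) (hB : is_bernoulli B) (n : nat) :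
  hankel n (fun k => B (2 * k + 1)%N \Po ((2%:R : rat)^-1 *: ('X + 1))) =
  (-1) ^+ 'C(n.+1, 2) * ((2%:R : rat)^-1 *: 'X) ^+ n.+1 *
  \prod_(1 <= l < n.+1)
    ((l%:R ^+ 4 / (4%:R * (2%:R * l%:R + 1) * (2%:R * l%:R - 1)) : rat) *:
       ('X ^+ 2 - (l%:R ^+ 2)%:P)) ^+ (n.+1 - l)%N.
Proof.
set a := _ *: _; pose c m := B m \Po a.
have twice_a : 2 * a - 1 = 'X.
  by rewrite /a -mul_polyC mulrA -(rmorph_nat polyC) -rmorphM divff //
    mul1r addrK.
(* Up to x / 2 in each row, P and Q are the row and column scalings that take
   the Hilbert matrix to the Gram matrix. *)
pose P k : {poly rat} := \prod_(l < k) (- l.+1%:R * ('X + l.+1%:R)).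
pose Q k : {poly rat} := \prod_(l < k) (l.+1%:R * ('X - l.+1%:R)).
have gramE i j : odd_umbral c (wilson_basis a i * wilson_basis (1 - a) j) =
    (2^-1 *: 'X * P i) * ((i + j).+1%:R^-1)%:P * Q j.
  have := odd_umbral_wilson i j (umbral_shift hB a); rewrite twice_a.
  rewrite -/(P i) -/(Q j) -scaler_nat => /(congr1 ( *:%R (2 * (i + j).+1)%:R^-1)).
  rewrite scalerA mulVf ?Num.Theory.pnatr_eq0 // scale1r => ->.
  rewrite natrM invfM -!mul_polyC rmorphM /=; ring.
have -> : hankel n (fun k => B (2 * k + 1)%N \Po a) =
    \det (\matrix_(i < n.+1, j < n.+1) odd_umbral c 'X^(i + j)).
  by congr (\det _); apply/matrixP => i j; rewrite !mxE odd_umbralXn.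
rewrite -(det_gram_monic (odd_umbral c) n.+1 (wilson_basisP a)
           (wilson_basisP (1 - a))).
transitivity (\det (\matrix_(i < n.+1, j < n.+1)
    ((2^-1 *: 'X * P i) * ((i + j).+1%:R^-1)%:P * Q j))).
  by congr (\det _); apply/matrixP => i j; rewrite !mxE; apply: gramE.
rewrite (det_scale n.+1 (fun i => 2^-1 *: 'X * P i) Q
           (fun i j => ((i + j).+1%:R^-1)%:P)).
have -> : \matrix_(i < n.+1, j < n.+1) ((i + j).+1%:R^-1)%:P =
    map_mx polyC (\matrix_(i < n.+1, j < n.+1) ((i + j).+1%:R : rat)^-1).
  by apply/matrixP => i j; rewrite !mxE.
rewrite det_map_mx det_hilbert rmorph_prod prod_staircase -big_split /=.
have -> : (-1) ^+ 'C(n.+1, 2) * (2^-1 *: 'X) ^+ n.+1 =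
    \prod_(i < n.+1) ((-1) ^+ i * (2^-1 *: 'X)) :> {poly rat}.
  rewrite big_split prodr_const card_ord -bin2_sum big_mkord.
  by rewrite (big_morph _ (exprD _) (expr0 _)).
rewrite -big_split; apply: eq_bigr => i _ /=.
have -> : (-1) ^+ i = \prod_(l < i) (-1) :> {poly rat}.
  by rewrite prodr_const card_ord.
rewrite -!mulrA [RHS]mulrCA; congr (_ * _).
(* With m = l + 1, the factor m^2 (x^2 - m^2), up to sign, is m (x + m) from
   the row scaling times m (x - m) from the column scaling. *)
rewrite (rmorph_prod polyC) /P /Q -!big_split; apply: eq_bigr => l _ /=.
rewrite -!mul_polyC.
have -> : l.+1%:R ^+ 4 / (4 * (2 * l.+1%:R + 1) * (2 * l.+1%:R - 1)) =
    l.+1%:R ^+ 2 * (l.+1%:R ^+ 2 / (4 * (2 * l%:R + 1) * (2 * l%:R + 3))) :> rat.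
  rewrite -natr1; field.
  by rewrite -natrM -natrD natr1 !Num.Theory.pnatr_eq0 addn3.
rewrite polyCM polyC_exp polyC_natr; ring.
Qed.
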